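(* Let $d\ge2$ and $\sigma=(\sigma^{(1)},\dots,\sigma^{(d-1)})\in(\mathcal D^\infty_{\ge0})^{d-1}$. Then $\sigma$ is feasible for $n=(n_1,\dots,n_d)\in\mathbb N^d$ if and only if $\deg(\sigma^{(1)})\le n_1$, $\deg(\sigma^{(d-1)})\le n_d$, and for each $\mu=2,\dots,d-1$ the pair $(\sigma^{(\mu-1)},\sigma^{(\mu)})$ is feasible for $(\deg(\sigma^{(\mu-1)}),\,n_\mu,\,\deg(\sigma^{(\mu)}))$.
   Context: $\mathbb K\in\{\mathbb R,\mathbb C\}$ is fixed. $\mathcal D^\infty_{\ge0}$ is the set of weakly decreasing sequences of non-negative reals with finitely many nonzero entries; $\deg(v)$ is the number of positive entries of $v$. For a tensor $A\in\mathbb K^{n_1\times\dots\times n_d}$ and $\mu=1,\dots,d-1$, $A^{(\{1,\dots,\mu\})}\in\mathbb K^{n_1\cdots n_\mu\times n_{\mu+1}\cdots n_d}$ is the matricization with rows indexed by $(i_1,\dots,i_\mu)$, columns indexed by $(i_{\mu+1},\dots,i_d)$ and entries $A(i_1,\dots,i_d)$. The TT-singular values of $A$ are $\mathrm{sv}_{TT}(A)=(\sigma^{(1)},\dots,\sigma^{(d-1)})$ with $\sigma^{(\mu)}$ the weakly decreasing sequence of singular values of $A^{(\{1,\dots,\mu\})}$, extended by zeros. A tuple $\sigma\in(\mathcal D^\infty_{\ge0})^{d-1}$ is called feasible for $n=(n_1,\dots,n_d)$ if there exists $A\in\mathbb K^{n_1\times\dots\times n_d}$ with $\sigma=\mathrm{sv}_{TT}(A)$.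 In particular (the case of third-order tensors), a pair $(\gamma,\theta)$ is feasible for $(k_1,m,k_2)$ if there is $B\in\mathbb K^{k_1\times m\times k_2}$ with $\mathrm{sv}(B^{(\{1\})})=\gamma$ and $\mathrm{sv}(B^{(\{1,2\})})=\theta$ (a tensor having a mode of size $0$ is understood to have only zero singular values). *)

(* Defs.v *)
From mathcomp Require Import all_boot all_order all_algebra.
From mathcomp Require Import finmap sesquilinear complex reals.

Set Implicit Arguments.
Unset Strict Implicit.
Unset Printing Implicit Defensive.

Import Order.TTheory GRing.Theory Num.Theory.

Local Open Scope ring_scope.
Local Open Scope complex_scope.

(* A field over R with a conjugation: the common interface of the two ground
   fields R and R[i], which are [real_scalars] and [complex_scalars]. *)
Record scalars (R : realType) := Scalars {
  scalar :> fieldType;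
  of_real : {rmorphism R -> scalar};
  scalar_conj : {rmorphism scalar -> scalar} }.

Definition real_scalars (R : realType) : scalars R :=
  @Scalars R R idfun idfun.

Definition complex_scalars (R : realType) : scalars R :=
  @Scalars R R[i] (real_complex R) (@conjc R).

(* Sequences are indexed from 0: [v 0] is the first, largest, entry.  The type
   {fsfun nat -> R with 0} already imposes finitely many nonzero entries. *)
Notation fseq R := {fsfun nat -> R with 0}.

Definition weakly_decreasing_nonneg (R : realType) (v : fseq R) : Prop :=
  (forall i j, (i <= j)%N -> v j <= v i) /\ (forall i, 0 <= v i).

Definition deg (R : realType) (v : fseq R) : nat :=
  #|` [fset i in finsupp v | 0 < v i]%fset |.

Section SingularValues.
Variables (R : realType) (K : scalars R).

Definition adjoint m n (M : 'M[K]_(m, n)) : 'M[K]_(n, m) :=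
  map_mx (scalar_conj K) M^T.

(* Orthogonal over R, unitary over R[i]. *)
Definition unitary n (U : 'M[K]_n) : Prop := adjoint U *m U = 1%:M.

(* [is_sv M s]: M = U S V^* is a singular value decomposition in which the
   diagonal of the rectangular matrix S lists the first min(m, n) entries of s,
   all later entries of s being zero.  For m = 0 or n = 0 this forces s = 0. *)
Definition is_sv m n (M : 'M[K]_(m, n)) (s : fseq R) : Prop :=
  [/\ weakly_decreasing_nonneg s,
      forall i, (minn m n <= i)%N -> s i = 0
    & exists U : 'M[K]_m, exists V : 'M[K]_n,
      [/\ unitary U, unitary V
        & M = U *m (\matrix_(i < m, j < n) (of_real K (s i) *+ (i == j :> nat)))
                *m adjoint V]].

End SingularValues.

Section Tensors.
Variables (R : realType) (K : scalars R) (d : nat) (n : d.-tuple nat).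

Definition multi_index := {dffun forall i : 'I_d, 'I_(tnth n i)}.

Definition tensor := {ffun multi_index -> K}.

Definition partial_index (S : pred 'I_d) :=
  {dffun forall i : {i : 'I_d | S i}, 'I_(tnth n (val i))}.

Definition merge_index (S : pred 'I_d) (r : partial_index S)
    (c : partial_index (predC S)) : multi_index :=
  finfun (fun i : 'I_d =>
    match boolP (S i) return 'I_(tnth n i) with
    | AltTrue Si => r (exist _ i Si)
    | AltFalse nSi => c (exist _ i nSi)
    end).

(* Row and column multi-indices are numbered by their enumerations as finite
   types; this choice of ordering does not affect singular values. *)
Definition matricization (S : pred 'I_d) (A : tensor) :
    'M[K]_(#|{: partial_index S}|, #|{: partial_index (predC S)}|) :=
  \matrix_(a, b) A (merge_index (enum_val a) (enum_val b)).

(* Modes and entries of s are numbered from 0: entry mu of s belongs to the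
   unfolding whose rows are indexed by the first mu.+1 modes 0, ..., mu. *)
Definition is_sv_TT (A : tensor) (s : d.-1.-tuple (fseq R)) : Prop :=
  forall mu : 'I_d.-1,
    is_sv (matricization (fun i : 'I_d => (i <= mu)%N) A) (tnth s mu).

End Tensors.

Definition feasible (R : realType) (K : scalars R) (d : nat)
    (n : d.-tuple nat) (s : d.-1.-tuple (fseq R)) : Prop :=
  exists A : tensor K n, is_sv_TT A s.

Definition pair_feasible (R : realType) (K : scalars R)
    (g t : fseq R) (k1 m k2 : nat) : Prop :=
  @feasible R K 3 [tuple k1; m; k2] [tuple g; t].

(* Main.v *)
Require Import Defs.
From mathcomp Require Import all_boot all_order all_algebra.
From mathcomp Require Import finmap complex boolp reals.

Set Implicit Arguments.
Unset Strict Implicit.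
Unset Printing Implicit Defensive.

(** Feasibility of a whole tuple of TT-singular values is a local condition.

    Write D_c for the diagonal matrix of the positive entries of sigma^(c), an
    invertible matrix of order deg sigma^(c).  In the canonical form
    A(i_1, ..., i_d) = G_1(i_1) D_1 G_2(i_2) D_2 ... D_(d-1) G_d(i_d)
    each cut of the product at a D_c is a thin singular value decomposition of
    the corresponding unfolding, provided that the first core is a left
    isometry, the last one a right isometry, and every interior core G between
    D and D' satisfies sum_i (D G_i)^H (D G_i) = 1 and
    sum_i (G_i D') (G_i D')^H = 1 ([canonical_core]).  This last condition
    involves two consecutive members of the tuple only.  Hence [feasibleP]:
    sigma is feasible if and only if the first and last degrees fit into the
    outer modes and a canonical core exists for each interior mode.

    Necessity is [canonical_core_of_svd].  If F(x, i, z) = U_x D V_iz is a thin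
    decomposition of one unfolding and F(x, i, z) = U'_xi D' V'_z one of the
    next, then comparing the two through the isometries U and V' yields
    U'_xi = U_x D G_i and V_iz = G_i D' V'_z with the single matrix
    G_i = D^-1 sum_x U_x^H U'_xi; the isometry conditions on U' and V become
    the two conditions on G.

    Sufficiency is [contraction_unfolding_svd].  Multiplying the cores from the
    left up to a cut preserves the left isometry, and multiplying them from the
    right down to the cut preserves the right isometry.

    The theorem follows by using [feasibleP] twice: for sigma itself, and for
    the third-order tensors of size (deg s, m, deg t), where the degree
    conditions hold trivially and only the existence of one core remains.

    Two translations connect this argument with matricizations.  [is_svP]
    passes from full to thin decompositions, by completing isometries to
    unitary matrices, which needs square roots of squared norms.
    [is_sv_matricizationP] replaces dependent multi-indices by lists of natural
    numbers, where cutting a multi-index is cutting a list. *)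

Import Order.TTheory GRing.Theory Num.Theory.
Local Open Scope ring_scope.

Local Notation "A ^H" := (adjoint A) (at level 8, format "A ^H").

(** * The two ground fields *)

(** All that the argument uses of the ground field: an inner product on
    coordinate spaces whose squared norms lie in R and vanish only at 0. *)
Definition hermitian_scalars (R : realType) (K : scalars R) : Prop :=
  [/\ involutive (scalar_conj K),
      forall x, scalar_conj K (of_real K x) = of_real K x
    & forall z, exists2 y, 0 <= y &
        z * scalar_conj K z = of_real K y /\ (y = 0 -> z = 0)].

Lemma real_or_complex_hermitian (R : realType) (K : scalars R) :
  K = real_scalars R \/ K = complex_scalars R -> hermitian_scalars K.
Proof.
case=> ->; split=> //=.
- move=> x; exists (x ^+ 2); first exact: sqr_ge0.
  by split=> [|/eqP]; rewrite ?expr2 // mulf_eq0 orbb => /eqP.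
- exact: conjcK.
- by move=> x; rewrite oppr0.
- case=> a b; exists (a ^+ 2 + b ^+ 2); first by rewrite addr_ge0 ?sqr_ge0.
  split; last first.
    move/eqP; rewrite paddr_eq0 ?sqr_ge0// !expf_eq0 /=.
    by case/andP => /eqP -> /eqP ->.
  apply/eqP; rewrite eq_complex /=; apply/andP; split; apply/eqP.
    by rewrite mulrN opprK !expr2.
  by rewrite mulrN mulrC addNr.
Qed.

(** * Degrees *)

Section Deg.
Variables (R : realType) (s : fseq R).
Hypothesis s_wd : weakly_decreasing_nonneg s.

(** In a weakly decreasing sequence the positive entries form an initial
    segment, so the degree is the position of the first zero. *)
Lemma deg_gt0P i : (0 < s i) = (i < deg s)%N.
Proof.
have [s_dec s_ge0] := s_wd.
have ex0 : exists i, s i == 0.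
  exists (\max_(j <- finsupp s) j).+1; rewrite fsfun_dflt //.
  apply/negP => js.
  by have := @leq_bigmax_seq _ _ xpredT (fun j : nat => j) _ js isT;
     rewrite ltnn.
case: (ex_minnP ex0) => r /eqP sr0 r_min.
have pos j : (0 < s j) = (j < r)%N.
  case: ltnP => [jr|rj]; last first.
    by apply/negbTE; rewrite -leNgt (le_trans (s_dec _ _ rj)) // sr0.
  by rewrite lt_def s_ge0 andbT; apply: contraTN jr => /r_min; rewrite -leqNgt.
suff -> : deg s = r by [].
have -> : deg s = #|` [fset j in iota 0 r]%fset |.
  congr #|` _|; apply/fsetP => j; rewrite !inE /= mem_iota add0n -pos.
  rewrite andb_idl // => sj; apply: contraTT sj => /fsfun_dflt ->.
  by rewrite ltxx.
by rewrite card_fseq undup_id ?iota_uniq // size_iota.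
Qed.

Lemma deg_le_eq0 i : (deg s <= i)%N -> s i = 0.
Proof.
rewrite leqNgt -deg_gt0P; case: s_wd => _ /(_ i).
by rewrite le_eqVlt => /orP[/eqP <- //|->].
Qed.

End Deg.

(** * Adjoints *)

Section Hermitian.
Variables (R : realType) (K : scalars R).
Hypothesis hK : hermitian_scalars K.

Local Notation conj := (scalar_conj K).

Lemma adjointK m n (A : 'M[K]_(m, n)) : A^H^H = A.
Proof. by case: hK => cK _ _; apply/matrixP => i j; rewrite !mxE cK. Qed.

Lemma adjointM m n p (A : 'M[K]_(m, n)) (B : 'M_(n, p)) :
  (A *m B)^H = B^H *m A^H.
Proof. by rewrite /adjoint trmx_mul map_mxM. Qed.

Lemma adjoint_pid m n r : (pid_mx r : 'M[K]_(m, n))^H = pid_mx r.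
Proof. by rewrite /adjoint tr_pid_mx map_pid_mx. Qed.

Lemma adjoint_mul_sum m n (A : 'M[K]_(m, n)) :
  A^H *m A = \sum_i (row i A)^H *m row i A.
Proof.
apply/matrixP => a b; rewrite summxE mxE; apply: eq_bigr => i _.
by rewrite !mxE big_ord1 !mxE.
Qed.

Lemma mul_adjoint_sum m n (A : 'M[K]_(m, n)) :
  A *m A^H = \sum_j col j A *m (col j A)^H.
Proof.
apply/matrixP => a b; rewrite summxE mxE; apply: eq_bigr => i _.
by rewrite !mxE big_ord1 !mxE.
Qed.

(** * Completing isometries *)

Lemma exists_unit_vector n (v : 'cV[K]_n) : v != 0 ->
  exists2 c : K, c != 0 & (c *: v)^H *m (c *: v) = 1%:M.
Proof.
move=> v0; case: hK => cK creal cpos.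
have [y [y0 ye ynz]] : exists y : 'I_n -> R, [/\ forall i, 0 <= y i,
    forall i, v i 0 * conj (v i 0) = of_real K (y i)
    & forall i, y i = 0 -> v i 0 = 0].
  have H i : exists y, [/\ 0 <= y, v i 0 * conj (v i 0) = of_real K y
      & (y = 0 -> v i 0 = 0)].
    by have [y ? [? ?]] := cpos (v i 0); exists y.
  by exists (fun i => projT1 (cid (H i))); split=> i; case: cid => y [].
(* t is the squared norm of v. *)
pose t := \sum_i y i.
have t0 : 0 < t.
  rewrite lt_def sumr_ge0 // andbT; apply: contraNneq v0 => /eqP.
  rewrite psumr_eq0 // => /allP yi0; apply/eqP/matrixP => i j.
  by rewrite !mxE ord1; apply: ynz; apply/eqP/yi0; rewrite mem_index_enum.
exists (of_real K (Num.sqrt t)^-1).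
  by rewrite fmorph_eq0 invr_eq0 sqrtr_eq0 -ltNge.
apply/matrixP => a b; rewrite !ord1 !mxE /=.
under eq_bigr => i _ do
  rewrite !mxE rmorphM creal /= mulrACA -rmorphM [conj _ * _]mulrC ye -rmorphM.
rewrite -rmorph_sum -mulr_sumr -/t -invrM ?unitfE ?sqrtr_eq0 -?ltNge //.
by rewrite -expr2 sqr_sqrtr ?ltW // mulVf ?rmorph1 // gt_eqF.
Qed.

(** The kernel of U^H is not trivial because U has fewer columns than rows. *)
Lemma exists_orthogonal_unit m p (U : 'M[K]_(m, p)) : (p < m)%N ->
  exists2 v : 'cV[K]_m, U^H *m v = 0 & v^H *m v = 1%:M.
Proof.
move=> pm; set A := kermx (U^H)^T.
have /rowV0Pn[w wA w0] : A != 0.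
  rewrite kermx_eq0 /row_free; apply: contraTneq pm => rk.
  by rewrite -leqNgt -{1}rk rank_leq_col.
have [|c _ cw] := @exists_unit_vector m w^T.
  by apply: contraNneq w0 => /(congr1 trmx); rewrite trmxK trmx0 => ->.
exists (c *: w^T) => //; rewrite -scalemxAr.
apply/eqP; rewrite scaler_eq0; apply/orP; right.
by rewrite -[_ == 0]trmx_eq0 trmx_mul trmxK; apply/eqP/sub_kermxP.
Qed.

(** An isometry with fewer columns than rows leaves room for one more
    orthonormal column; repeating this fills up the square. *)
Lemma isometry_completion m p (U : 'M[K]_(m, p)) : (p <= m)%N ->
  U^H *m U = 1%:M -> exists2 W : 'M[K]_m, unitary W & W *m pid_mx p = U.
Proof.
move=> /subnK; move: (m - p)%N => k; elim: k p U => [|k IHk] p U.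
  rewrite add0n => pm; case: m / pm U => U UU.
  by exists U; last by rewrite pid_mx_1 mulmx1.
move=> kpm UU; have pm : (p < m)%N by rewrite -kpm addSn ltnS leq_addl.
have [v Uv vv] := exists_orthogonal_unit U pm.
have [||W WW Wp] := IHk (p + 1)%N (row_mx U v).
- by rewrite addn1 -addSnnS.
- rewrite /adjoint tr_row_mx map_col_mx mul_col_row -!/(adjoint _) UU Uv vv.
  rewrite -[v^H *m U]adjointK adjointM adjointK Uv.
  by rewrite /adjoint trmx0 map_mx0 -scalar_mx_block.
exists W => //; transitivity (row_mx U v *m (pid_mx p : 'M_(p + 1, p))).
  rewrite -Wp -mulmxA mul_pid_mx; congr (_ *m pid_mx _).
  by rewrite !(minn_idPr (leq_addr 1 p)).
by rewrite pid_mx_col mul_row_col mulmx1 mulmx0 addr0.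
Qed.

(** * Thin singular value decompositions *)

Definition sv_diag (s : fseq R) : 'M[K]_(deg s) :=
  diag_mx (\row_k of_real K (s k)).

Lemma sv_diag_unit s : weakly_decreasing_nonneg s -> sv_diag s \in unitmx.
Proof.
move=> s_wd; rewrite unitmxE det_diag unitfE; apply/prodf_neq0 => i _.
by rewrite mxE fmorph_eq0 gt_eqF // deg_gt0P.
Qed.

(** Isometric matrices given by their rows, respectively columns, indexed by an
    arbitrary list: this is what lets an index be a pair of a prefix and a mode
    without any reshaping. *)
Definition left_isometry r (X : Type) (I : seq X) (U : X -> 'rV[K]_r) : Prop :=
  \sum_(x <- I) (U x)^H *m U x = 1%:M.

Definition right_isometry r (Y : Type) (J : seq Y) (V : Y -> 'cV[K]_r) : Prop :=
  \sum_(y <- J) V y *m (V y)^H = 1%:M.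

(** The inner dimension is the degree of s, so that the diagonal factor is
    invertible. *)
Definition thin_svd (X Y : eqType) (I : seq X) (J : seq Y) (F : X -> Y -> K)
    (s : fseq R) : Prop :=
  exists U : X -> 'rV[K]_(deg s), exists V : Y -> 'cV[K]_(deg s),
    [/\ left_isometry I U, right_isometry J V
      & {in I & J, forall x y, (F x y)%:M = U x *m sv_diag s *m V y}].

(** The identity of order r is a sum of [size I] matrices of rank at most 1. *)
Lemma left_isometry_le r (X : Type) (I : seq X) (U : X -> 'rV[K]_r) :
  left_isometry I U -> (r <= size I)%N.
Proof.
move=> UU; rewrite -(mxrank1 K r) -UU.
elim: I {UU} => [|x I IHI]; first by rewrite big_nil mxrank0.
rewrite big_cons (leq_trans (mxrank_add _ _)) //=.
rewrite -[(size I).+1]add1n leq_add //.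
by rewrite (leq_trans (mxrankM_maxr _ _)) // rank_leq_row.
Qed.

Lemma right_isometry_le r (Y : Type) (J : seq Y) (V : Y -> 'cV[K]_r) :
  right_isometry J V -> (r <= size J)%N.
Proof.
move=> VV; apply: (@left_isometry_le _ _ _ (fun y => (V y)^H)).
by rewrite /left_isometry -[RHS]VV; apply: eq_bigr => y _; rewrite adjointK.
Qed.

(** Entries of s past its degree vanish, so they only multiply zeros: dropping
    the corresponding columns of the unitary factors makes the decomposition
    thin, and [isometry_completion] restores them.  The vanishing of s beyond
    min(m, n) is equivalent to deg s <= min(m, n), which an isometry of deg s
    columns forces by itself. *)
Lemma is_svP m n (M : 'M[K]_(m, n)) s :
  is_sv M s <->
  weakly_decreasing_nonneg s /\
  thin_svd (enum 'I_m) (enum 'I_n) (fun i j => M i j) s.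
Proof.
(* The rectangular diagonal matrix only involves its leading square block. *)
have padE : weakly_decreasing_nonneg s -> (deg s <= m)%N -> (deg s <= n)%N ->
    \matrix_(i < m, j < n) (of_real K (s i) *+ (i == j :> nat)) =
    pid_mx (deg s) *m sv_diag s *m pid_mx (deg s).
  move=> s_wd rm rn; apply/matrixP => i j; rewrite mul_mx_diag !mxE.
  have [ir|ri] := ltnP i (deg s); last first.
    rewrite (deg_le_eq0 s_wd ri) rmorph0 mul0rn big1 // => k _.
    by rewrite !mxE ltnNge ri andbF !mul0r.
  rewrite (bigD1 (Ordinal ir)) //= big1 => [|k /negbTE ki]; rewrite !mxE.
    by rewrite eqxx ir mul1r addr0 andbT mulr_natr.
  by rewrite -val_eqE /= eq_sym in ki; rewrite ki !mul0r.
have pid1 p : (deg s <= p)%N ->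
    (pid_mx (deg s) : 'M[K]_(deg s, p)) *m pid_mx (deg s) = 1%:M.
  by move=> rp; rewrite mul_pid_mx minnn (minn_idPr rp) pid_mx_1.
split=> [[s_wd s0 [U [V [UU VV ME]]]]|[s_wd [U [V [UU VV ME]]]]].
  split=> //; have rk : (deg s <= minn m n)%N.
    by rewrite leqNgt -deg_gt0P // s0 ?ltxx.
  move: (rk); rewrite leq_min => /andP[rm rn].
  pose U1 := U *m pid_mx (deg s) : 'M_(m, deg s).
  pose V1 := pid_mx (deg s) *m adjoint V : 'M_(deg s, n).
  exists (fun i => row i U1), (fun j => col j V1); split.
  - rewrite /left_isometry big_enum -adjoint_mul_sum adjointM adjoint_pid.
    by rewrite mulmxA -[_ *m _ *m U]mulmxA UU mulmx1 pid1.
  - rewrite /right_isometry big_enum -mul_adjoint_sum adjointM adjoint_pid.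
    by rewrite adjointK mulmxA -[_ *m _ *m V]mulmxA VV mulmx1 pid1.
  - move=> i j _ _; rewrite ME padE // !mulmxA.
    apply/matrixP => a b; rewrite !ord1 mxE eqxx mulr1n.
    rewrite -row_mul -[_ *m pid_mx _ *m _]mulmxA -/U1 -/V1.
    by rewrite !mxE; apply: eq_bigr => k _; rewrite !mxE.
have rm : (deg s <= m)%N.
  by rewrite (leq_trans (left_isometry_le UU)) ?size_enum_ord.
have rn : (deg s <= n)%N.
  by rewrite (leq_trans (right_isometry_le VV)) ?size_enum_ord.
split=> // [i|].
  by rewrite geq_min => /orP[] /(leq_trans _) H; apply: deg_le_eq0; rewrite ?H.
pose U1 := \matrix_i U i; pose V1 := \matrix_(k, j) V j k 0.
have rowU i : row i U1 = U i by rewrite rowK.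
have colV j : col j V1 = V j by apply/matrixP => a b; rewrite !mxE ord1.
have [|U2 UU2 U2E] := @isometry_completion _ _ U1 rm.
  rewrite adjoint_mul_sum -[RHS]UU big_enum; apply: eq_bigr => i _.
  by rewrite rowU.
have [|V2 VV2 V2E] := @isometry_completion _ _ V1^H rn.
  rewrite adjointK mul_adjoint_sum -[RHS]VV big_enum; apply: eq_bigr => i _.
  by rewrite colV.
exists U2, V2; split=> //; rewrite padE // !mulmxA U2E -mulmxA.
rewrite -[pid_mx _ *m adjoint V2]adjointK adjointM adjoint_pid adjointK V2E.
rewrite adjointK; apply/matrixP => i j.
have := ME i j; rewrite !mem_enum => /(_ isT isT)/matrixP/(_ 0 0).
rewrite mxE eqxx mulr1n => ->; rewrite -rowU -colV -row_mul.
by rewrite !mxE; apply: eq_bigr => k _; rewrite !mxE.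
Qed.

Lemma thin_svd_eq (X Y : eqType) (I I' : seq X) (J J' : seq Y) F F' s :
  perm_eq I I' -> perm_eq J J' -> {in I & J, F =2 F'} ->
  thin_svd I J F s -> thin_svd I' J' F' s.
Proof.
move=> II JJ FF [U [V [UU VV FE]]]; exists U, V; split.
- by rewrite /left_isometry -[RHS]UU; apply/esym/perm_big.
- by rewrite /right_isometry -[RHS]VV; apply/esym/perm_big.
- move=> x y; rewrite -(perm_mem II) -(perm_mem JJ) => xI yJ.
  by rewrite -FF // FE.
Qed.

(** Singular values do not depend on how rows and columns are labelled. *)
Lemma thin_svd_map (A B : finType) (X Y : eqType) (f : A -> X)
    (g : B -> Y) F s :
  injective f -> injective g ->
  thin_svd (enum A) (enum B) (fun i j => F (f i) (g j)) s <->
  thin_svd (map f (enum A)) (map g (enum B)) F s.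
Proof.
move=> f_inj g_inj; split=> [] [U [V [UU VV FE]]]; last first.
  exists (U \o f), (V \o g); split.
  - by rewrite /left_isometry -[RHS]UU [RHS]big_map.
  - by rewrite /right_isometry -[RHS]VV [RHS]big_map.
  - by move=> i j iA jB; rewrite FE ?map_f.
pose inv (C : finType) (Z : eqType) (h : C -> Z) z := [pick i | h i == z].
have invK (C : finType) (Z : eqType) (h : C -> Z) i :
    injective h -> inv C Z h (h i) = Some i.
  move=> h_inj; rewrite /inv; case: pickP => [k /eqP/h_inj -> //|/(_ i)].
  by rewrite eqxx.
exists (fun x => oapp U 0 (inv _ _ f x)).
exists (fun y => oapp V 0 (inv _ _ g y)); split.
- rewrite /left_isometry -[RHS]UU [LHS]big_map.
  by apply: eq_bigr => i _; rewrite invK.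
- rewrite /right_isometry -[RHS]VV [LHS]big_map.
  by apply: eq_bigr => i _; rewrite invK.
- move=> x y /mapP[i iA ->] /mapP[j jB ->]; rewrite !invK //=.
  exact: FE.
Qed.

(** * Three-mode cores *)

(** The condition on one interior core of a tensor train in canonical (Vidal)
    form, the neighbouring diagonal factors being those of s and t. *)
Definition canonical_core (T : Type) (s t : fseq R) (N : seq T)
    (G : T -> 'M[K]_(deg s, deg t)) : Prop :=
  \sum_(i <- N) (sv_diag s *m G i)^H *m (sv_diag s *m G i) = 1%:M /\
  \sum_(i <- N) (G i *m sv_diag t) *m (G i *m sv_diag t)^H = 1%:M.

(** Two decompositions of the same three-mode tensor, one for each cut, share
    a core: G_i = D^-1 M_i below translates between their outer factors. *)
Lemma canonical_core_of_svd (X T Y : eqType) (I : seq X) (N : seq T) (J : seq Y)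
    (s t : fseq R) (U : X -> 'rV[K]_(deg s)) (V : T -> Y -> 'cV[K]_(deg s))
    (U' : X -> T -> 'rV[K]_(deg t)) (V' : Y -> 'cV[K]_(deg t)) :
  weakly_decreasing_nonneg s -> weakly_decreasing_nonneg t ->
  left_isometry I U -> \sum_(i <- N) \sum_(z <- J) V i z *m (V i z)^H = 1%:M ->
  \sum_(x <- I) \sum_(i <- N) (U' x i)^H *m U' x i = 1%:M ->
  right_isometry J V' ->
  (forall x i z, x \in I -> i \in N -> z \in J ->
     U x *m sv_diag s *m V i z = U' x i *m sv_diag t *m V' z) ->
  exists G : T -> 'M[K]_(deg s, deg t), canonical_core N G.
Proof.
move=> s_wd t_wd UU VV UU' VV' E.
have Ds := sv_diag_unit s_wd; have Dt := sv_diag_unit t_wd.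
pose M i := \sum_(x <- I) (U x)^H *m U' x i.
exists (fun i => invmx (sv_diag s) *m M i).
have VE i z : i \in N -> z \in J ->
    V i z = invmx (sv_diag s) *m M i *m sv_diag t *m V' z.
  move=> iN zJ; rewrite -!mulmxA; apply: (canRL (mulKmx Ds)).
  rewrite -[LHS]mul1mx -[in LHS]UU /M !mulmx_suml.
  apply: eq_big_seq => x xI; rewrite -!mulmxA; congr (_ *m _).
  by rewrite !mulmxA E.
have UE x i : x \in I -> i \in N -> U' x i = U x *m M i.
  move=> xI iN; apply: (can_inj (mulmxK Dt)).
  rewrite -[LHS]mulmx1 -VV' mulmx_sumr.
  transitivity (U x *m M i *m sv_diag t *m \sum_(z <- J) V' z *m (V' z)^H).
    rewrite mulmx_sumr; apply: eq_big_seq => z zJ.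
    rewrite !mulmxA -E // VE //; congr (_ *m _).
    by rewrite !mulmxA mulmxK.
  by rewrite VV' mulmx1.
split.
  rewrite -[RHS]UU' exchange_big; apply: eq_big_seq => i iN.
  rewrite mulKVmx //.
  transitivity ((M i)^H *m (\sum_(x <- I) (U x)^H *m U x) *m M i).
    by rewrite UU mulmx1.
  rewrite mulmx_sumr mulmx_suml; apply: eq_big_seq => x xI.
  by rewrite UE // adjointM !mulmxA.
rewrite -[RHS]VV; apply: eq_big_seq => i iN.
set H := (_ *m _ *m sv_diag t).
transitivity (H *m (\sum_(z <- J) V' z *m (V' z)^H) *m H^H).
  by rewrite VV' mulmx1.
rewrite mulmx_sumr mulmx_suml; apply: eq_big_seq => z zJ.
by rewrite VE // -/H (adjointM H) !mulmxA.
Qed.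

End Hermitian.

(** * Boxes of multi-indices *)

Fixpoint box (ns : seq nat) : seq (seq nat) :=
  if ns is n :: ns' then [seq j :: x | j <- iota 0 n, x <- box ns']
  else [:: [::]].

Lemma size_box ns : size (box ns) = foldr muln 1%N ns.
Proof. by elim: ns => //= n ns IHns; rewrite size_allpairs size_iota IHns. Qed.

Lemma mem_box_cons n ns j x :
  (j :: x \in box (n :: ns)) = (j < n)%N && (x \in box ns).
Proof.
apply/allpairsP/andP => [[[i y] /=]|[jn xns]].
  by rewrite mem_iota => -[lti yns [-> ->]].
by exists (j, x); rewrite mem_iota.
Qed.

Lemma size_mem_box ns x : x \in box ns -> size x = size ns.
Proof.
elim: ns x => [|n ns IHns] x; first by rewrite inE => /eqP ->.
by case/allpairsP => -[j y] /= [_ /IHns <- ->].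
Qed.

Lemma map_mem_box (T : eqType) (r : seq T) (f g : T -> nat) :
  {in r, forall i, f i < g i}%N -> map f r \in box (map g r).
Proof.
elim: r => [|i r IHr] fg; first by rewrite inE.
rewrite mem_box_cons fg ?mem_head //= IHr // => j jr.
by rewrite fg // inE jr orbT.
Qed.

Lemma big_box_cons (V : nmodType) n ns (F : seq nat -> V) :
  \sum_(x <- box (n :: ns)) F x =
  \sum_(i <- iota 0 n) \sum_(x <- box ns) F (i :: x).
Proof. by rewrite /= big_allpairs_dep. Qed.

Lemma big_box_rcons (V : nmodType) ns n (F : seq nat -> V) :
  \sum_(x <- box (rcons ns n)) F x =
  \sum_(x <- box ns) \sum_(i <- iota 0 n) F (rcons x i).
Proof.
elim: ns F => [|m ns IHns] F.
  rewrite big_box_cons big_seq1.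
  by apply: eq_bigr => i _; rewrite big_seq1.
rewrite [LHS]big_box_cons [RHS]big_box_cons.
by apply: eq_bigr => j _; rewrite -/(rcons _ _) IHns.
Qed.

Lemma mem_box_rcons ns n x j :
  x \in box ns -> (j < n)%N -> rcons x j \in box (rcons ns n).
Proof.
move=> + jn; elim: ns x => [|m ns IHns] [|i x] //.
- by rewrite mem_box_cons jn.
- by move/size_mem_box.
- by rewrite !rcons_cons !mem_box_cons => /andP[-> /IHns].
Qed.

(** Forgetting the dependent types lets row and column indices be concatenated
    without casts. *)
Definition values (X : finType) (h : X -> nat)
    (F : {dffun forall x, 'I_(h x)}) : seq nat :=
  [seq (F x : nat) | x <- enum X].

Lemma values_inj (X : finType) (h : X -> nat) : injective (@values X h).
Proof.
move=> F F' FF; apply/ffunP => x; apply: val_inj.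
have /eq_in_map := FF; apply; by rewrite mem_enum.
Qed.

(** [values] is injective into the box, and both sides have the same
    cardinality, the product of the mode sizes; so every list of the box is the
    list of values of exactly one multi-index. *)
Lemma perm_values_box (X : finType) (h : X -> nat) :
  perm_eq (map (@values X h) (enum {dffun forall x, 'I_(h x)}))
          (box (map h (enum X))).
Proof.
have u : uniq (map (@values X h) (enum {dffun forall x, 'I_(h x)})).
  by rewrite map_inj_uniq ?enum_uniq //; apply: values_inj.
have sub : {subset map (@values X h) (enum {dffun forall x, 'I_(h x)})
              <= box (map h (enum X))}.
  by move=> _ /mapP[F _ ->]; apply: map_mem_box.
have sz : size (map (@values X h) (enum {dffun forall x, 'I_(h x)})) =
          size (box (map h (enum X))).
  rewrite size_map -cardE card_dep_ffun size_box; congr foldr.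
  by apply: eq_map => x; rewrite card_ord.
apply: uniq_perm => //; last by have [] := uniq_min_size u sub; rewrite sz.
by rewrite -(eq_uniq sz) //; have [] := uniq_min_size u sub; rewrite sz.
Qed.

(** * Matricizations as cuts of lists *)

Section Unfolding.
Variables (R : realType) (K : scalars R) (d : nat) (n : d.-tuple nat).

Lemma map_val_enum_sub (P : pred 'I_d) :
  map val (enum {: {i | P i}}) = filter P (enum 'I_d).
Proof.
transitivity (map val (pmap insub (enum 'I_d) : seq {i | P i})).
  by rewrite !enumT [in LHS]unlock.
rewrite pmap_filter; last exact: insubK.
by apply: eq_filter => i; rewrite isSome_insub.
Qed.

Lemma filter_enum_ord (mu : nat) : (mu < d)%N ->
  [seq i : 'I_d <- enum 'I_d | (i <= mu)%N] = take mu.+1 (enum 'I_d) /\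
  [seq i : 'I_d <- enum 'I_d | ~~ (i <= mu)%N] = drop mu.+1 (enum 'I_d).
Proof.
move=> mud; have iotaE : iota 0 d = iota 0 mu.+1 ++ iota mu.+1 (d - mu.+1).
  by rewrite -{2}[mu.+1]add0n -iotaD subnKC.
split; apply: (inj_map val_inj).
  rewrite map_take val_enum_ord.
  rewrite -(filter_map val (fun j => j <= mu)%N) val_enum_ord.
  rewrite -[mu in LHS]add0n filter_iota_leq // iotaE take_size_cat //.
  by rewrite size_iota.
rewrite map_drop val_enum_ord.
rewrite -(filter_map val (fun j => ~~ (j <= mu))%N) val_enum_ord.
rewrite iotaE drop_size_cat ?size_iota // filter_cat.
rewrite (eq_in_filter (a2 := pred0)) ?filter_pred0.
  rewrite (eq_in_filter (a2 := predT)) ?filter_predT // => j.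
  by rewrite mem_iota -ltnNge => /andP[].
by move=> j; rewrite mem_iota ltnS => /andP[_ ->].
Qed.

(** The modes of a prefix come first in the enumeration, so merging a row index
    with a column index concatenates their lists of values. *)
Lemma values_merge (mu : 'I_d.-1) (P := fun i : 'I_d => (i <= mu)%N)
    (r : partial_index n P) (c : partial_index n (predC P)) :
  values (merge_index r c) = values r ++ values c.
Proof.
have mud : (mu < d)%N by rewrite (leq_trans (ltn_ord mu)) ?leq_pred.
have [takeE dropE] := filter_enum_ord mud.
have enumE : enum 'I_d = filter P (enum 'I_d) ++ filter (predC P) (enum 'I_d).
  by rewrite [filter (predC P) _]dropE [filter P _]takeE cat_take_drop.
rewrite {1}/values enumE map_cat -!map_val_enum_sub.
congr (_ ++ _); rewrite -map_comp /values; apply: eq_map => -[i Pi] /=;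
  rewrite /merge_index ffunE.
  case: {-}_ / boolP => [Pi'|nPi]; first by rewrite (bool_irrelevance Pi' Pi).
  by case/negP: nPi.
case: {-}_ / boolP => [Pi'|nPi]; first by case/negP: Pi.
by rewrite (bool_irrelevance nPi Pi).
Qed.

Lemma box_prefix (mu : 'I_d.-1) (P := fun i : 'I_d => (i <= mu)%N) :
  [seq tnth n (val i) | i : {i | P i}] = take mu.+1 n /\
  [seq tnth n (val i) | i : {i | predC P i}] = drop mu.+1 n.
Proof.
have mud : (mu < d)%N by rewrite (leq_trans (ltn_ord mu)) ?leq_pred.
have [takeE dropE] := filter_enum_ord mud.
split; rewrite /image_mem (map_comp (tnth n) val) map_val_enum_sub.
  by rewrite takeE map_take map_tnth_enum.
by rewrite [filter _ _]dropE map_drop map_tnth_enum.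
Qed.

Definition seq_tensor (A : tensor K n) (x : seq nat) : K :=
  oapp A 0 [pick i : multi_index n | values i == x].

Lemma seq_tensorE A (i : multi_index n) : seq_tensor A (values i) = A i.
Proof.
rewrite /seq_tensor; case: pickP => [j /eqP/values_inj -> //|/(_ i)].
by rewrite eqxx.
Qed.

Definition unfolding_svd (c : nat) (ns : seq nat) (F : seq nat -> K)
    (s : fseq R) : Prop :=
  thin_svd (box (take c ns)) (box (drop c ns)) (fun x y => F (x ++ y)) s.

Lemma is_sv_matricizationP (hK : hermitian_scalars K) (A : tensor K n)
    (F : seq nat -> K) (mu : 'I_d.-1) s :
  (forall i : multi_index n, F (values i) = A i) ->
  is_sv (matricization (fun i : 'I_d => (i <= mu)%N) A) s <->
  weakly_decreasing_nonneg s /\ unfolding_svd mu.+1 n F s.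
Proof.
move=> AF; rewrite is_svP //; set P := fun i : 'I_d => _.
have [takeE dropE] := box_prefix mu.
pose f (a : 'I_#|{: partial_index n P}|) := values (enum_val a).
pose g (b : 'I_#|{: partial_index n (predC P)}|) := values (enum_val b).
have f_inj : injective f by move=> a a' /values_inj/enum_val_inj.
have g_inj : injective g by move=> b b' /values_inj/enum_val_inj.
(* A matricization numbers its rows and columns by the enumeration of the
   multi-indices, hence the order of the box is only met up to permutation. *)
have enumE (T : finType) : perm_eq (map enum_val (enum 'I_#|T|)) (enum T).
  apply: uniq_perm; rewrite ?enum_uniq //.
    by rewrite map_inj_uniq ?enum_uniq //; apply: enum_val_inj.
  move=> i; rewrite mem_enum; apply/mapP; exists (enum_rank i).
    by rewrite mem_enum.
  by rewrite enum_rankK.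
have fE : perm_eq (map f (enum 'I_ _)) (box (take mu.+1 n)).
  rewrite /f (map_comp (fun x => values x)) -takeE.
  exact: perm_trans (perm_map _ (enumE _)) (perm_values_box _).
have gE : perm_eq (map g (enum 'I_ _)) (box (drop mu.+1 n)).
  rewrite /g (map_comp (fun x => values x)) -dropE.
  exact: perm_trans (perm_map _ (enumE _)) (perm_values_box _).
have eqF a b : matricization P A a b = F (f a ++ g b).
  by rewrite mxE -AF values_merge.
split=> -[s_wd H]; split=> //.
  apply: thin_svd_eq fE gE _ (_ : thin_svd _ _ (fun x y => F (x ++ y)) s) => //.
  apply/thin_svd_map => //.
  by apply: thin_svd_eq H => // a b _ _; rewrite eqF.
have /thin_svd_map : thin_svd (map f (enum 'I_ _)) (map g (enum 'I_ _))
    (fun x y => F (x ++ y)) s.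
  by apply: thin_svd_eq H => //; rewrite perm_sym.
move=> /(_ f_inj g_inj).
by apply: thin_svd_eq => // a b _ _; rewrite eqF.
Qed.

End Unfolding.

(** * Canonical form of tensor trains *)

Section TT.
Variables (R : realType) (K : scalars R).
Hypothesis hK : hermitian_scalars K.

Definition has_canonical_core (s t : fseq R) (m : nat) : Prop :=
  exists G : nat -> 'M[K]_(deg s, deg t), canonical_core (iota 0 m) G.

Lemma canonical_core_of_unfoldings (ns : seq nat) (F : seq nat -> K) (c : nat)
    s t :
  (c.+1 < size ns)%N ->
  weakly_decreasing_nonneg s -> weakly_decreasing_nonneg t ->
  unfolding_svd c.+1 ns F s -> unfolding_svd c.+2 ns F t ->
  has_canonical_core s t (nth 0%N ns c.+1).
Proof.
move=> cns s_wd t_wd [U [V [UU VV UV]]] [U' [V' [UU' VV' UV']]].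
rewrite (drop_nth 0%N cns) in VV UV; rewrite (take_nth 0%N cns) in UU' UV'.
apply: (@canonical_core_of_svd _ _ _ _ _ (box (take c.+1 ns)) _
  (box (drop c.+2 ns)) _ _ U (fun i z => V (i :: z))
  (fun x i => U' (rcons x i)) V').
- exact: s_wd.
- exact: t_wd.
- exact: UU.
- by rewrite -[RHS]VV big_box_cons.
- by rewrite -[RHS]UU' big_box_rcons.
- exact: VV'.
- move=> x i z xI; rewrite mem_iota /= add0n => iN zJ.
  by rewrite /= -UV ?mem_box_cons ?iN ?zJ // -UV' ?mem_box_rcons // cat_rcons.
Qed.

(** The outermost core: isometric as soon as its mode has size at least r, the
    surplus rows being 0. *)
Definition basis_row r (j : nat) : 'rV[K]_r := \row_k (j == k)%:R.

Lemma sum_basis_row r n : (r <= n)%N ->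
  \sum_(j <- iota 0 n) (basis_row r j)^H *m basis_row r j = 1%:M.
Proof.
move=> rn; rewrite -[n in iota 0 n]subn0 big_mkord.
transitivity ((pid_mx r : 'M[K]_(n, r))^H *m (pid_mx r : 'M[K]_(n, r))).
  rewrite adjoint_mul_sum; apply: eq_bigr => j _.
  suff -> : row j (pid_mx r) = basis_row r j by [].
  apply/matrixP => a k; rewrite !mxE; case: eqP => [jk|] //.
  by rewrite jk ltn_ord.
by rewrite adjoint_pid mul_pid_mx minnn (minn_idPr rn) pid_mx_1.
Qed.

Section Contraction.
Variables (ns : seq nat) (sigma : nat -> fseq R) (p : nat).
Hypothesis size_ns : size ns = p.+2.
Hypothesis first_deg : (deg (sigma 0) <= nth 0 ns 0)%N.
Hypothesis last_deg : (deg (sigma p) <= nth 0 ns p.+1)%N.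
Variable G : forall c, nat -> 'M[K]_(deg (sigma c), deg (sigma c.+1)).
Hypothesis core_G : forall c, (c < p)%N ->
  canonical_core (iota 0 (nth 0%N ns c.+1)) (G c).

(** Only the entries 0, ..., c of x are read, so that the same function serves a
    prefix and every list extending it. *)
Fixpoint prefix_row (c : nat) (x : seq nat) : 'rV[K]_(deg (sigma c)) :=
  match c with
  | 0 => basis_row _ (nth 0%N x 0)
  | c.+1 => prefix_row c x *m sv_diag K (sigma c) *m G c (nth 0%N x c.+1)
  end.

Definition contraction (x : seq nat) : K :=
  (prefix_row p x *m sv_diag K (sigma p) *m
     (basis_row _ (nth 0%N x p.+1))^H) 0 0.

Lemma prefix_row_cat c x y : (c < size x)%N ->
  prefix_row c (x ++ y) = prefix_row c x.
Proof.
elim: c => [|c IHc] cx /=; first by rewrite nth_cat cx.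
by rewrite IHc ?nth_cat ?cx // ltnW.
Qed.

(** Each interior core is left isometric after multiplication by the diagonal
    factor on its left, so the isometry passes from a prefix to the next one. *)
Lemma prefix_row_isometry c : (c <= p)%N ->
  left_isometry (box (take c.+1 ns)) (prefix_row c).
Proof.
have ltn_ns k : (k <= p.+1)%N -> (k < size ns)%N by rewrite size_ns.
rewrite /left_isometry; elim: c => [|c IHc] cp.
  rewrite (take_nth 0%N) ?ltn_ns // take0 big_box_rcons big_seq1 /=.
  exact: sum_basis_row.
rewrite (take_nth 0%N) ?ltn_ns ?(leqW cp) // big_box_rcons exchange_big /=.
have [core1 _] := core_G cp; rewrite -[RHS]core1.
apply: eq_big_seq => i _; set M := sv_diag _ _ *m G c i.
transitivity (M^H *m (\sum_(x <- box (take c.+1 ns))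
    (prefix_row c x)^H *m prefix_row c x) *m M); last first.
  by rewrite IHc ?mulmx1 // ltnW.
rewrite mulmx_sumr mulmx_suml; apply: eq_big_seq => x /size_mem_box.
rewrite size_takel ?size_ns ?ltnS ?(leq_trans (ltnW cp)) // => xsz.
rewrite -cats1 prefix_row_cat ?xsz // nth_cat xsz ltnn subnn /=.
by rewrite -!(mulmxA (prefix_row c x)) -/M adjointM !mulmxA.
Qed.

(** The mirror image of [prefix_row_isometry], descending from the last mode.
    The columns come with the factorization of the tensor at cut c, since each
    descent step moves one core of that factorization from the row to the
    column. *)
Lemma exists_suffix_col c : (c <= p)%N ->
  exists2 V : seq nat -> 'cV[K]_(deg (sigma c)),
    right_isometry (box (drop c.+1 ns)) V
  & forall x z, size x = c.+1 -> z \in box (drop c.+1 ns) ->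
      (contraction (x ++ z))%:M = prefix_row c x *m sv_diag K (sigma c) *m V z.
Proof.
have ltn_ns k : (k <= p.+1)%N -> (k < size ns)%N by rewrite size_ns.
move=> cp; have [k def_p] : exists k, p = (c + k)%N.
  by exists (p - c)%N; rewrite subnKC.
elim: k c def_p cp => [|k IHk] c def_p cp.
  rewrite addn0 in def_p; subst c.
  exists (fun z => (basis_row _ (nth 0%N z 0))^H).
    rewrite /right_isometry (drop_nth 0%N) ?ltn_ns // drop_oversize ?size_ns //.
    rewrite big_box_cons -[RHS](sum_basis_row last_deg).
    by apply: eq_bigr => i _; rewrite big_seq1 adjointK.
  move=> x z xsz _; rewrite /contraction nth_cat prefix_row_cat ?xsz //.
  by rewrite ltnn subnn; apply/matrixP => a b; rewrite !ord1 mxE eqxx mulr1n.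
have cp' : (c < p)%N by rewrite def_p addnS ltnS leq_addr.
have [|V VV TV] := IHk c.+1 _ cp'; first by rewrite def_p addSnnS.
exists (fun z => G c (head 0%N z) *m sv_diag K (sigma c.+1) *m V (behead z)).
  rewrite /right_isometry (drop_nth 0%N) ?ltn_ns ?ltnS // big_box_cons.
  have [_ core2] := core_G cp'; rewrite -[RHS]core2.
  apply: eq_bigr => i _; rewrite /=; set M := _ *m sv_diag _ _.
  transitivity (M *m (\sum_(z <- box (drop c.+2 ns)) V z *m (V z)^H) *m M^H).
    rewrite mulmx_sumr mulmx_suml; apply: eq_bigr => z _.
    by rewrite (adjointM M) !mulmxA.
  by rewrite [\sum_(z <- _) _]VV mulmx1.
move=> x z xsz; rewrite (drop_nth 0%N) ?ltn_ns ?ltnS //.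
case: z => [/size_mem_box //|i z]; rewrite mem_box_cons => /andP[_ zJ].
rewrite -cat_rcons TV ?size_rcons ?xsz //= -cats1 prefix_row_cat ?xsz //.
by rewrite nth_cat xsz ltnn subnn /= !mulmxA.
Qed.

Lemma contraction_unfolding_svd c : (c <= p)%N ->
  unfolding_svd c.+1 ns contraction (sigma c).
Proof.
move=> cp; have [V VV TV] := exists_suffix_col cp.
exists (prefix_row c), V; split=> //; first exact: prefix_row_isometry.
move=> x y /size_mem_box xsz; apply: TV.
by rewrite xsz size_takel // size_ns ltnS ltnW.
Qed.

End Contraction.

(** The degree conditions account for the outermost cores, which are isometries
    without any further constraint. *)
Lemma feasibleP (d : nat) (hd : (2 <= d)%N) (n : d.-tuple nat)
    (sigma : d.-1.-tuple (fseq R))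
    (hsigma : forall mu : 'I_d.-1, weakly_decreasing_nonneg (tnth sigma mu)) :
  feasible K n sigma <->
  [/\ (deg (nth [fsfun] sigma 0) <= nth 0 n 0)%N,
      (deg (nth [fsfun] sigma d.-2) <= nth 0 n d.-1)%N
    & forall mu : nat, (2 <= mu <= d.-1)%N ->
        has_canonical_core (nth [fsfun] sigma mu.-2) (nth [fsfun] sigma mu.-1)
          (nth 0%N n mu.-1)].
Proof.
case: d hd n sigma hsigma => [|[|p]] // _ n sigma hsigma /=.
have wd c : (c <= p)%N -> weakly_decreasing_nonneg (nth [fsfun] sigma c).
  move=> cp; have := hsigma (Ordinal (cp : (c < p.+1)%N)).
  by rewrite (tnth_nth [fsfun]).
have ns_size : size n = p.+2 by rewrite size_tuple.
split=> [[A AE]|[deg1 deg2 cores]].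
  have AF c : (c <= p)%N ->
      unfolding_svd c.+1 n (seq_tensor A) (nth [fsfun] sigma c).
    move=> cp; have := AE (Ordinal (cp : (c < p.+1)%N)).
    rewrite (tnth_nth [fsfun]).
    by case/(is_sv_matricizationP hK _ _ (seq_tensorE A)).
  split.
  - have [U [_ [UU _ _]]] := AF 0%N isT; have := left_isometry_le UU.
    by rewrite size_box (take_nth 0%N) ?ns_size // take0 /= muln1.
  - have [_ [V [_ VV _]]] := AF p (leqnn p); have := right_isometry_le hK VV.
    rewrite size_box (drop_nth 0%N) ?ns_size // drop_oversize ?ns_size //=.
    by rewrite muln1.
  - case=> [|[|c]] //= cp.
    by apply: (canonical_core_of_unfoldings _ (wd _ _) (wd _ _)
                 (AF c _) (AF c.+1 _));
      rewrite ?ns_size // ltnW.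
pose sg := nth [fsfun] sigma.
(* One choice for all cuts at once; beyond the last interior mode any core
   will do. *)
have [G GE] : exists G : forall c, nat -> 'M[K]_(deg (sg c), deg (sg c.+1)),
    forall c, (c < p)%N ->
      canonical_core (iota 0 (nth 0%N n c.+1)) (G c).
  have H c : exists Gc : nat -> 'M[K]_(deg (sg c), deg (sg c.+1)),
      (c < p)%N -> canonical_core (iota 0 (nth 0%N n c.+1)) Gc.
    have [cp|_] := ltnP c p; last by exists (fun _ => 0).
    by have [Gc GcE] := cores c.+2 cp; exists Gc.
  by exists (fun c => projT1 (cid (H c))) => c cp; case: cid => Gc /=; apply.
exists [ffun i : multi_index n => contraction p G (values i)] => mu.
apply/(is_sv_matricizationP hK (F := contraction p G)).
  by move=> i; rewrite ffunE.
split=> //; rewrite (tnth_nth [fsfun]).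
by apply: contraction_unfolding_svd => //; rewrite -ltnS.
Qed.

End TT.

(* Tuples are indexed from 0, so mode mu.+1 of the usual 1-based numbering is
   [nth 0 n mu], and the mu-th unfolding has singular values
   [nth [fsfun] sigma mu.-1]. *)
Theorem corollary2p9 (R : realType) (K : scalars R)
    (hK : K = real_scalars R \/ K = complex_scalars R)
    (d : nat) (hd : (2 <= d)%N) (n : d.-tuple nat)
    (sigma : d.-1.-tuple (fseq R))
    (hsigma : forall mu : 'I_d.-1, weakly_decreasing_nonneg (tnth sigma mu)) :
  feasible K n sigma <->
  [/\ (deg (nth [fsfun] sigma 0) <= nth 0 n 0)%N,
      (deg (nth [fsfun] sigma d.-2) <= nth 0 n d.-1)%N
    & forall mu : nat, (2 <= mu <= d.-1)%N ->
        pair_feasible K (nth [fsfun] sigma mu.-2) (nth [fsfun] sigma mu.-1)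
          (deg (nth [fsfun] sigma mu.-2)) (nth 0%N n mu.-1)
          (deg (nth [fsfun] sigma mu.-1))].
Proof.
have hermK := real_or_complex_hermitian hK.
have wd c : (c < d.-1)%N -> weakly_decreasing_nonneg (nth [fsfun] sigma c).
  by move=> cd; have := hsigma (Ordinal cd); rewrite (tnth_nth [fsfun]).
(* The outer modes of the third-order tensor have exactly the sizes deg s and
   deg t, which makes the degree conditions of [feasibleP] reflexive. *)
have pairP mu : (2 <= mu <= d.-1)%N ->
    pair_feasible K (nth [fsfun] sigma mu.-2) (nth [fsfun] sigma mu.-1)
      (deg (nth [fsfun] sigma mu.-2)) (nth 0%N n mu.-1)
      (deg (nth [fsfun] sigma mu.-1)) <->
    has_canonical_core K (nth [fsfun] sigma mu.-2) (nth [fsfun] sigma mu.-1)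
      (nth 0%N n mu.-1).
  case: mu => [|[|c]] //= cd; rewrite /pair_feasible feasibleP //; last first.
    case=> [[|[|i]]] //= ?; rewrite (tnth_nth [fsfun]) /=; apply: wd => //.
    exact: ltnW.
  split=> [[_ _ /(_ 2%N isT)] //|core].
  by split=> //= -[|[|[|mu]]].
rewrite feasibleP //; split=> -[deg1 deg2 H]; split=> // mu hmu.
  by apply/pairP => //; apply: H.
by apply/pairP => //; apply: H.
Qed.
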